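(* Let $\mathcal A$ be an algebra, $\mathcal D$ an $\mathcal A$-bimodule, and $1=e_I+e_J$ an orthogonal idempotent decomposition in $\mathcal A$. Let $\mathcal F$ be an $\mathcal A$-subbimodule of $\mathcal D$ contained in $\mathcal D_{\mathrm{mix}}$ and let $\mathcal V=\mathcal D/\mathcal F$ be the quotient bimodule. Suppose that there exists an $\mathcal A_{\mathrm{diag}}$-bilinear derivation $f:\mathcal A\to\mathcal V$ with $f(\mathcal A)=\mathcal V_{\mathrm{mix}}$. Then, for $\ast\in\{\sharp,\flat\}$, $$\mathfrak d_\ast(\mathcal A,\mathcal D)\ \ge\ \mathfrak d_\ast(\mathcal A_I,\mathcal D_I)+\mathfrak d_\ast(\mathcal A_J,\mathcal D_J).$$ In particular, if $\mathcal D$ is prehomogeneous (resp. pseudoprehomogeneous), then so are the bimodules $\mathcal D_I$ over $\mathcal A_I$ and $\mathcal D_J$ over $\mathcal A_J$.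
   Context: Everything is over an algebraically closed field $\Bbbk$ of arbitrary characteristic; algebras are finite-dimensional, associative and unital (the zero algebra is allowed), and bimodules are finite-dimensional. For an algebra $\mathcal A$ and an $\mathcal A$-bimodule $\mathcal D$ and $\lambda,\mu\in\mathcal D$ let $S_{\lambda,\mu}:\mathcal A\to\mathcal D$, $S_{\lambda,\mu}(a)=a\lambda-\mu a$, and $S_\lambda=S_{\lambda,\lambda}$. The corank of a linear map is the dimension of its cokernel. Put $$\mathfrak d_\sharp(\mathcal A,\mathcal D)=\min_{\lambda\in\mathcal D}\operatorname{corank}S_\lambda,\qquad \mathfrak d_\flat(\mathcal A,\mathcal D)=\min_{\lambda,\mu\in\mathcal D}\operatorname{corank}S_{\lambda,\mu}.$$ $\mathcal D$ is prehomogeneous if $\mathfrak d_\sharp(\mathcal A,\mathcal D)=0$ (equivalently, the unit group $\mathcal A^\times$ acting on $\mathcal D$ by conjugation has an open orbit), and pseudoprehomogeneous if $\mathfrak d_\flat(\mathcal A,\mathcal D)=0$. Given $1=e_I+e_J$ with $e_I,e_J$ orthogonal idempotents, put $\mathcal A_{PQ}=e_P\mathcal Ae_Q$, $\mathcal D_{PQ}=e_P\mathcal De_Q$ for $P,Q\in\{I,J\}$; $\mathcal A_P=\mathcal A_{PP}$ (an algebra with unit $e_P$), $\mathcal D_P=\mathcal D_{PP}$ (an $\mathcal A_P$-bimodule); $\mathcal A_{\mathrm{diag}}=\mathcal A_I\oplus\mathcal A_J$; $\mathcal D_{\mathrm{mix}}=\mathcal D_{IJ}\oplus\mathcal D_{JI}$,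 and similarly $\mathcal V_{\mathrm{mix}}=e_I\mathcal Ve_J\oplus e_J\mathcal Ve_I=\mathcal D_{\mathrm{mix}}/\mathcal F$. A derivation $f:\mathcal A\to\mathcal V$ is a linear map with $f(ab)=af(b)+f(a)b$; it is $\mathcal A_{\mathrm{diag}}$-bilinear if it is a homomorphism of $\mathcal A_{\mathrm{diag}}$-bimodules (equivalently, if $f$ vanishes on $\mathcal A_{\mathrm{diag}}$). *)

(* Defs.v *)
From HB Require Import structures.
From mathcomp Require Import all_boot all_algebra.
From mathcomp Require Import boolp.

Set Implicit Arguments.
Unset Strict Implicit.
Unset Printing Implicit Defensive.

Import GRing.Theory.
Local Open Scope quotient_scope.
Local Open Scope ring_scope.

Reserved Notation "a ** b" (at level 40, left associativity).

(* MathComp's algType and falgType extend nzRingType, hence exclude the zero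
   algebra, which occurs here as the corner e A e of e = 0; and the hierarchy
   has no common extension point for pzRingType and lmodType. The product is
   therefore declared directly on a vectType. *)
HB.mixin Record Vector_isFDAlgebra (K : fieldType) (A : Type)
    of Vector K A := {
  fdmul : A -> A -> A;
  fdone : A;
  fdmul_linearl : forall b : A, linear (fdmul ^~ b);
  fdmul_linearr : forall a : A, linear (fdmul a);
  fdmulA : associative fdmul;
  fdmul1a : left_id fdone fdmul;
  fdmula1 : right_id fdone fdmul
}.

#[short(type="fdAlgType")]
HB.structure Definition FDAlgebra (K : fieldType) :=
  { A of Vector K A & Vector_isFDAlgebra K A }.

Notation "a ** b" := (fdmul a b) : ring_scope.

HB.mixin Record Vector_isBimodule (K : fieldType) (A : fdAlgType K) (D : Type)
    of Vector K D := {
  lact : A -> D -> D;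
  ract : D -> A -> D;
  lact_linearl : forall d : D, linear (lact ^~ d);
  lact_linearr : forall a : A, linear (lact a);
  ract_linearl : forall a : A, linear (ract ^~ a);
  ract_linearr : forall d : D, linear (ract d);
  lact1 : forall d : D, lact fdone d = d;
  ract1 : forall d : D, ract d fdone = d;
  lactM : forall (a b : A) (d : D), lact (a ** b) d = lact a (lact b d);
  ractM : forall (d : D) (a b : A), ract d (a ** b) = ract (ract d a) b;
  lactA : forall (a : A) (d : D) (b : A), ract (lact a d) b = lact a (ract d b)
}.

#[short(type="bimodType")]
HB.structure Definition Bimodule (K : fieldType) (A : fdAlgType K) :=
  { D of Vector K D & Vector_isBimodule K A D }.

Section VectorQuotient.
Variables (K : fieldType) (V : vectType K) (U : {vspace V}).

Definition vquot : Type := Quotient.quot (pred_of_vspace U).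
HB.instance Definition _ := GRing.Zmodule.on vquot.

Definition vpi (v : V) : vquot := \pi_(Quotient.quot (pred_of_vspace U)) v.
Definition vrepr (q : vquot) : V := repr q.

Lemma vreprK : cancel vrepr vpi.
Proof. exact: reprK. Qed.

Lemma vpi_eq (v w : V) : (vpi v == vpi w) = (v - w \in U).
Proof. exact/esym/Quotient.idealrBE. Qed.

Lemma vpiD : {morph vpi : v w / v + w}.
Proof. exact: (raddfD \pi_(Quotient.quot (pred_of_vspace U))). Qed.

Definition vquot_scale (k : K) (q : vquot) : vquot := vpi (k *: vrepr q).

Lemma vquot_scale_pi k v : vquot_scale k (vpi v) = vpi (k *: v).
Proof.
by apply/eqP; rewrite vpi_eq -scalerBr memvZ // -vpi_eq vreprK.
Qed.

Fact vquot_scaleA a b q :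
  vquot_scale a (vquot_scale b q) = vquot_scale (a * b) q.
Proof. by rewrite -[q]vreprK !vquot_scale_pi scalerA. Qed.

Fact vquot_scale1 : left_id 1 vquot_scale.
Proof. by move=> q; rewrite -[q]vreprK vquot_scale_pi scale1r. Qed.

Fact vquot_scaleDr : right_distributive vquot_scale +%R.
Proof.
move=> k p q; rewrite -[p]vreprK -[q]vreprK -vpiD !vquot_scale_pi.
by rewrite scalerDr vpiD.
Qed.

Fact vquot_scaleDl q : {morph vquot_scale^~ q : a b / a + b}.
Proof. by move=> a b; rewrite -[q]vreprK !vquot_scale_pi scalerDl vpiD. Qed.

HB.instance Definition _ := GRing.Zmodule_isLmodule.Build K vquot
  vquot_scaleA vquot_scale1 vquot_scaleDr vquot_scaleDl.

Fact vpi_is_linear : linear vpi.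
Proof. by move=> k v w; rewrite vpiD -vquot_scale_pi. Qed.
HB.instance Definition _ :=
  GRing.isLinear.Build K V vquot *:%R vpi vpi_is_linear.

Lemma vpi_projC v : vpi (v - projv U v) = vpi v.
Proof. by apply/eqP; rewrite vpi_eq addrAC subrr sub0r memvN memv_proj. Qed.

Lemma projC_eq v w : v - w \in U -> v - projv U v = w - projv U w.
Proof.
move=> vwU; have : projv U (v - w) = v - w by rewrite projv_id.
rewrite linearB /= => e; rewrite -{1}[v](subrK w) -e -[_ - _ + w]addrA [LHS]addrAC.
by rewrite subrr add0r addrC.
Qed.

Fact vquot_vect_iso : Vector.axiom (\dim (U^C)) vquot.
Proof.
pose s q : subvs_of U^C := Subvs (memv_projC U (vrepr q)).
have s_lin : linear s.
  move=> k p q; apply/subvs_inj; rewrite linearP /=.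
  rewrite scalerBr addrACA -opprD -linearP.
  by apply: projC_eq; rewrite -vpi_eq vreprK linearP /= !vreprK.
have s_bij : bijective s.
  exists (fun w => vpi (vsval w)) => [q | w] /=; first by rewrite vpi_projC vreprK.
  apply/val_inj => /=.
  rewrite (@projC_eq _ (vsval w)); last by rewrite -vpi_eq vreprK.
  have: vsval w - (vsval w - projv U (vsval w)) \in U.
    by rewrite opprB addrC subrK memv_proj.
  have wC := subvsP w; have pC := memv_projC U (vsval w).
  move=> h; apply/eqP; rewrite -subr_eq0 -memv0 -(capv_compl U) memv_cap.
  by rewrite -memvN opprB h /= memvB.
have [r r_lin r_bij] := subvs_vect_iso U^C.
by exists (r \o s); [move=> k p q /=; rewrite s_lin r_lin | apply: bij_comp].
Qed.
HB.instance Definition _ := Lmodule_hasFinDim.Build K vquot vquot_vect_iso.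

End VectorQuotient.

Definition subbimodule (K : fieldType) (A : fdAlgType K) (D : bimodType A)
    (F : {vspace D}) : Prop :=
  forall (a : A) (d : D), d \in F -> lact a d \in F /\ ract d a \in F.

Section BimoduleQuotient.
Variables (K : fieldType) (A : fdAlgType K) (D : bimodType A).
Variables (F : {vspace D}) (hF : subbimodule F).

Definition bquot of subbimodule F : Type := vquot F.
Local Notation V := (bquot hF).
HB.instance Definition _ := Vector.on V.

Definition bquot_lact (a : A) (q : V) : V := vpi F (lact a (vrepr q)).
Definition bquot_ract (q : V) (a : A) : V := vpi F (ract (vrepr q) a).

Lemma bquot_lact_pi a d : bquot_lact a (vpi F d) = vpi F (lact a d).
Proof.
have lB u v : lact a (u - v) = lact a u - lact a v.
  by rewrite -scaleN1r addrC lact_linearr scaleN1r addrC.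
by apply/eqP; rewrite vpi_eq -lB; case: (hF a (d := vrepr (vpi F d) - d)) => //;
  rewrite -vpi_eq vreprK.
Qed.

Lemma bquot_ract_pi d a : bquot_ract (vpi F d) a = vpi F (ract d a).
Proof.
have rB u v : ract (u - v) a = ract u a - ract v a.
  by rewrite -scaleN1r addrC ract_linearl scaleN1r addrC.
by apply/eqP; rewrite vpi_eq -rB; case: (hF a (d := vrepr (vpi F d) - d)) => //;
  rewrite -vpi_eq vreprK.
Qed.

Fact bquot_lact_linearl q : linear (bquot_lact ^~ q).
Proof. by move=> k a b; rewrite /bquot_lact lact_linearl linearP. Qed.

Fact bquot_lact_linearr a : linear (bquot_lact a).
Proof.
move=> k p q; rewrite -[p]vreprK -[q]vreprK -linearP.
by rewrite !bquot_lact_pi lact_linearr linearP.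
Qed.

Fact bquot_ract_linearl a : linear (bquot_ract ^~ a).
Proof.
move=> k p q; rewrite -[p]vreprK -[q]vreprK -linearP.
by rewrite !bquot_ract_pi ract_linearl linearP.
Qed.

Fact bquot_ract_linearr q : linear (bquot_ract q).
Proof. by move=> k a b; rewrite /bquot_ract ract_linearr linearP. Qed.

Fact bquot_lact1 q : bquot_lact fdone q = q.
Proof. by rewrite -[q]vreprK bquot_lact_pi lact1. Qed.

Fact bquot_ract1 q : bquot_ract q fdone = q.
Proof. by rewrite -[q]vreprK bquot_ract_pi ract1. Qed.

Fact bquot_lactM a b q : bquot_lact (a ** b) q = bquot_lact a (bquot_lact b q).
Proof. by rewrite -[q]vreprK !bquot_lact_pi lactM. Qed.

Fact bquot_ractM q a b : bquot_ract q (a ** b) = bquot_ract (bquot_ract q a) b.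
Proof. by rewrite -[q]vreprK !bquot_ract_pi ractM. Qed.

Fact bquot_lactA a q b :
  bquot_ract (bquot_lact a q) b = bquot_lact a (bquot_ract q b).
Proof.
by rewrite -[q]vreprK bquot_lact_pi !bquot_ract_pi bquot_lact_pi lactA.
Qed.

HB.instance Definition _ := Vector_isBimodule.Build K A V
  bquot_lact_linearl bquot_lact_linearr bquot_ract_linearl bquot_ract_linearr
  bquot_lact1 bquot_ract1 bquot_lactM bquot_ractM bquot_lactA.

End BimoduleQuotient.

Section Peirce.
Variables (K : fieldType) (A : fdAlgType K).

Definition acut (e e' a : A) : A := e ** a ** e'.

Fact acut_is_linear e e' : linear (acut e e').
Proof. by move=> k a b; rewrite /acut fdmul_linearr fdmul_linearl. Qed.
HB.instance Definition _ e e' := GRing.isLinear.Build K A A *:%R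
  (acut e e') (acut_is_linear e e').

(* e A e' *)
Definition apeirce (e e' : A) : {vspace A} :=
  limg (linfun (acut e e')).

Lemma apeirceP (e e' x : A) :
  reflect (exists a, x = e ** a ** e') (x \in apeirce e e').
Proof.
apply: (iffP memv_imgP) => [[a _ ->] | [a ->]]; exists a; rewrite ?lfunE //.
exact: memvf.
Qed.

Variable D : bimodType A.

Definition dcut (e e' : A) (d : D) : D := ract (lact e d) e'.

Fact dcut_is_linear e e' : linear (dcut e e').
Proof. by move=> k a b; rewrite /dcut lact_linearr ract_linearl. Qed.
HB.instance Definition _ e e' := GRing.isLinear.Build K D D *:%R
  (dcut e e') (dcut_is_linear e e').

(* e D e' *)
Definition dpeirce (e e' : A) : {vspace D} :=
  limg (linfun (dcut e e')).

Lemma dpeirceP (e e' : A) (x : D) :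
  reflect (exists d, x = ract (lact e d) e') (x \in dpeirce e e').
Proof.
apply: (iffP memv_imgP) => [[a _ ->] | [a ->]]; exists a; rewrite ?lfunE //.
exact: memvf.
Qed.

End Peirce.
Arguments dpeirce {K A} D e e'.

(* A_diag = A_I + A_J and D_mix = D_IJ + D_JI *)
Definition adiag (K : fieldType) (A : fdAlgType K) (eI eJ : A) : {vspace A} :=
  (apeirce eI eI + apeirce eJ eJ)%VS.

Definition dmix (K : fieldType) (A : fdAlgType K) (D : bimodType A)
    (eI eJ : A) : {vspace D} :=
  (dpeirce D eI eJ + dpeirce D eJ eI)%VS.
Arguments dmix {K A} D eI eJ.

(* The algebra e A e with unit e, and its bimodule e D e. *)
Section Corner.
Variables (K : fieldType) (A : fdAlgType K) (e : A) (he : e ** e = e).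

Definition corner of e ** e = e : Type := subvs_of (apeirce e e).
Local Notation B := (corner he).
HB.instance Definition _ := Vector.on B.

Lemma apeirce_id x : x \in apeirce e e -> e ** x = x /\ x ** e = x.
Proof.
case/apeirceP=> a ->; split; first by rewrite !fdmulA he.
by rewrite -[LHS]fdmulA he.
Qed.

Fact corner_mul_subproof (x y : B) : vsval x ** vsval y \in apeirce e e.
Proof.
have [ex _] := apeirce_id (subvsP x); have [_ ye] := apeirce_id (subvsP y).
by apply/apeirceP; exists (vsval x ** vsval y); rewrite fdmulA ex -fdmulA ye.
Qed.

Fact corner_one_subproof : e \in apeirce e e.
Proof. by apply/apeirceP; exists e; rewrite !he. Qed.

Definition corner_mul (x y : B) : B := Subvs (corner_mul_subproof x y).
Definition corner_one : B := Subvs corner_one_subproof.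

Fact corner_mul_linearl y : linear (corner_mul ^~ y).
Proof. by move=> k x x'; apply/subvs_inj/fdmul_linearl. Qed.

Fact corner_mul_linearr x : linear (corner_mul x).
Proof. by move=> k y y'; apply/subvs_inj/fdmul_linearr. Qed.

Fact corner_mulA : associative corner_mul.
Proof. by move=> x y z; apply/subvs_inj; rewrite /= fdmulA. Qed.

Fact corner_mul1x : left_id corner_one corner_mul.
Proof. by move=> x; apply/subvs_inj; case: (apeirce_id (subvsP x)). Qed.

Fact corner_mulx1 : right_id corner_one corner_mul.
Proof. by move=> x; apply/subvs_inj; case: (apeirce_id (subvsP x)). Qed.

HB.instance Definition _ := Vector_isFDAlgebra.Build K B
  corner_mul_linearl corner_mul_linearr corner_mulA corner_mul1x corner_mulx1.

Variable D : bimodType A.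

Definition bcorner of e ** e = e : Type := subvs_of (dpeirce D e e).
Local Notation C := (bcorner he).
HB.instance Definition _ := Vector.on C.

Lemma dpeirce_id x : x \in dpeirce D e e -> lact e x = x /\ ract x e = x.
Proof.
by case/dpeirceP=> d ->; rewrite -lactA -lactM he -ractM he.
Qed.

Fact bcorner_lact_subproof (x : B) (d : C) :
  lact (vsval x) (vsval d) \in dpeirce D e e.
Proof.
have [ex _] := apeirce_id (subvsP x); have [_ de] := dpeirce_id (subvsP d).
apply/dpeirceP; exists (lact (vsval x) (vsval d)).
by rewrite -lactM ex lactA de.
Qed.

Fact bcorner_ract_subproof (d : C) (x : B) :
  ract (vsval d) (vsval x) \in dpeirce D e e.
Proof.
have [_ xe] := apeirce_id (subvsP x); have [ed _] := dpeirce_id (subvsP d).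
apply/dpeirceP; exists (ract (vsval d) (vsval x)).
by rewrite -lactA ed -ractM xe.
Qed.

Definition bcorner_lact (x : B) (d : C) : C := Subvs (bcorner_lact_subproof x d).
Definition bcorner_ract (d : C) (x : B) : C := Subvs (bcorner_ract_subproof d x).

Fact bcorner_lact_linearl d : linear (bcorner_lact ^~ d).
Proof. by move=> k x x'; apply/subvs_inj/lact_linearl. Qed.

Fact bcorner_lact_linearr x : linear (bcorner_lact x).
Proof. by move=> k d d'; apply/subvs_inj/lact_linearr. Qed.

Fact bcorner_ract_linearl x : linear (bcorner_ract ^~ x).
Proof. by move=> k d d'; apply/subvs_inj/ract_linearl. Qed.

Fact bcorner_ract_linearr d : linear (bcorner_ract d).
Proof. by move=> k x x'; apply/subvs_inj/ract_linearr. Qed.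

Fact bcorner_lact1 d : bcorner_lact fdone d = d.
Proof. by apply/subvs_inj; case: (dpeirce_id (subvsP d)). Qed.

Fact bcorner_ract1 d : bcorner_ract d fdone = d.
Proof. by apply/subvs_inj; case: (dpeirce_id (subvsP d)). Qed.

Fact bcorner_lactM (x y : B) d :
  bcorner_lact (x ** y) d = bcorner_lact x (bcorner_lact y d).
Proof. by apply/subvs_inj; rewrite /= lactM. Qed.

Fact bcorner_ractM d (x y : B) :
  bcorner_ract d (x ** y) = bcorner_ract (bcorner_ract d x) y.
Proof. by apply/subvs_inj; rewrite /= ractM. Qed.

Fact bcorner_lactA x d y :
  bcorner_ract (bcorner_lact x d) y = bcorner_lact x (bcorner_ract d y).
Proof. by apply/subvs_inj; rewrite /= lactA. Qed.

HB.instance Definition _ := Vector_isBimodule.Build K B C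
  bcorner_lact_linearl bcorner_lact_linearr
  bcorner_ract_linearl bcorner_ract_linearr
  bcorner_lact1 bcorner_ract1 bcorner_lactM bcorner_ractM bcorner_lactA.

End Corner.
Arguments bcorner {K A e} D he.

Definition corank (K : fieldType) (V W : vectType K) (f : 'Hom(V, W)) : nat :=
  \dim {: vquot (limg f)}.

Lemma corankE (K : fieldType) (V W : vectType K) (f : 'Hom(V, W)) :
  corank f = (\dim {: W} - \dim (limg f))%N.
Proof. by rewrite /corank dimvf -dimv_compl. Qed.

Section Minimum.
Variables (T : Type) (x0 : T) (F : T -> nat).

Fact minval_subproof : exists n, `[< exists x, F x = n >].
Proof. by exists (F x0); apply/asboolP; exists x0. Qed.

(* The least value of F; x0 only witnesses that T is inhabited. *)
Definition minval : nat := ex_minn minval_subproof.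

Lemma minval_le x : (minval <= F x)%N.
Proof. by rewrite /minval; case: ex_minnP => m _; apply; apply/asboolP; exists x. Qed.

Lemma minval_attained : exists x, F x = minval.
Proof. by rewrite /minval; case: ex_minnP => m /asboolP. Qed.

End Minimum.

Section Defects.
Variables (K : fieldType) (A : fdAlgType K) (D : bimodType A).

Definition smap_fun (lam mu : D) (a : A) : D := lact a lam - ract mu a.

Fact smap_is_linear lam mu : linear (smap_fun lam mu).
Proof.
move=> k a b; rewrite /smap_fun lact_linearl ract_linearr.
by rewrite scalerBr opprD addrACA.
Qed.
HB.instance Definition _ lam mu :=
  GRing.isLinear.Build K A D *:%R (smap_fun lam mu) (smap_is_linear lam mu).

Definition smap (lam mu : D) : 'Hom(A, D) := linfun (smap_fun lam mu).

Lemma smapE lam mu a : smap lam mu a = lact a lam - ract mu a.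
Proof. by rewrite lfunE. Qed.

Definition dsharp : nat := minval 0 (fun lam : D => corank (smap lam lam)).

Definition dflat : nat :=
  minval (0, 0) (fun p : D * D => corank (smap p.1 p.2)).

Definition prehomogeneous : Prop := dsharp = 0%N.
Definition pseudoprehomogeneous : Prop := dflat = 0%N.

End Defects.
Arguments dsharp {K A} D.
Arguments dflat {K A} D.
Arguments prehomogeneous {K A} D.
Arguments pseudoprehomogeneous {K A} D.

Definition derivation (K : fieldType) (A : fdAlgType K) (V : bimodType A)
    (f : 'Hom(A, V)) : Prop :=
  forall a b : A, f (a ** b) = lact a (f b) + ract (f a) b.

Definition bilinear_over (K : fieldType) (A : fdAlgType K) (V : bimodType A)
    (B : {vspace A}) (f : 'Hom(A, V)) : Prop :=
  forall b a : A, b \in B ->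
    f (b ** a) = lact b (f a) /\ f (a ** b) = ract (f a) b.

(* Main.v *)
Require Import Defs.
From mathcomp Require Import all_boot all_algebra.
From mathcomp Require boolp.
From mathcomp Require Import zify.

(** Put V = D/F. The derivation f is used to deform the map S_(lam,mu) into the
    pencil T_s = f + s S_(lam,mu) : A -> V, which degenerates at s = 0 to f, a
    map that kills A_diag and covers V_mix.

    Pencils of this shape are transported by units: if u is a unit of A, then
    a |-> f(a) + a lam - mu a turns, up to left and right multiplication by
    units, into the map of the same shape with lam replaced by
    (f(u) + u lam) u^-1, the usual action of a gauge transformation on a
    connection ([gauge_pencil]). Since f covers V_mix, the off-diagonal part of
    the lowest order term in s of lam can be removed by a gauge transformation
    1 + s^n x with x in A_IJ or A_JI; such an x has square zero, so the inverse
    1 - s^n x is again polynomial in s. Iterating, s lam becomes diagonal modulo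
    an arbitrarily high power of s ([gauge_diagonal]).

    The rank is not lost on the way ([rank_perturb]): on r = rank S vectors
    whose images under S are independent, a suitable r x r minor of f + s S is a
    monic polynomial of degree r in s, so that it remains nonzero modulo
    s^(r+1) and hence the corresponding minor of any family congruent to f + s S
    modulo s^(r+1) is nonzero at some scalar s. This gives diagonal d, d' in V
    with rank (f + S_(d,d')) >= rank S_(lam,mu), and d = d' can be taken if
    lam = mu ([diagonal_pencil_rank]).

    For diagonal d and d' the map f + S_(d,d') respects the Peirce decomposition,
    and its rank is at most rank S_(d_I,d'_I) + rank S_(d_J,d'_J) + dim V_mix.
    As F lies in D_mix, D and V have the same diagonal corners, and comparing
    dimensions yields
    corank S_(d_I,d'_I) + corank S_(d_J,d'_J) <= corank S_(lam,mu)
    ([corank_corner_le]). *)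

Set Implicit Arguments.
Unset Strict Implicit.
Unset Printing Implicit Defensive.

Import GRing.Theory.
Local Open Scope ring_scope.

(** * Linear maps given by unbundled functions *)

Section LinearMaps.
Variables (K : fieldType) (X Y : lmodType K) (g : X -> Y).
Hypothesis g_lin : linear g.

Lemma linear_add u v : g (u + v) = g u + g v.
Proof. by have := g_lin 1 u v; rewrite !scale1r. Qed.

Lemma linear_zero : g 0 = 0.
Proof. by apply: (addrI (g 0)); rewrite -linear_add !addr0. Qed.

Lemma linear_scale k u : g (k *: u) = k *: g u.
Proof. by have := g_lin k u 0; rewrite linear_zero !addr0. Qed.

Lemma linear_opp u : g (- u) = - g u.
Proof. by rewrite -!scaleN1r linear_scale. Qed.

Lemma linear_sumE (I : Type) (r : seq I) (F : I -> X) :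
  g (\sum_(i <- r) F i) = \sum_(i <- r) g (F i).
Proof.
by elim: r => [|i r IH]; rewrite ?big_nil ?linear_zero // !big_cons linear_add IH.
Qed.

End LinearMaps.

(** * Polynomial curves and their order of vanishing *)

Section Order.
Variables (K : fieldType) (X : lmodType K).
Implicit Types (g h : K -> X) (n : nat).

(** The polynomial curves in X divisible by s^n. Listing monomials with their
    exponents, possibly repeated, makes closure under sums a concatenation. *)
Definition polyord n g : Prop :=
  exists l : seq (nat * X),
    forall s, g s = \sum_(t <- l) s ^+ (n + t.1) *: t.2.

Lemma polyord_ext n g h : (forall s, g s = h s) -> polyord n h -> polyord n g.
Proof. by move=> gh [l hl]; exists l => s; rewrite gh. Qed.

Lemma polyord_const c : polyord 0 (fun=> c).
Proof. by exists [:: (0%N, c)] => s; rewrite big_seq1 expr0 scale1r. Qed.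

Lemma polyord0 n : polyord n (fun=> 0).
Proof. by exists [::] => s; rewrite big_nil. Qed.

Lemma polyordD n g h :
  polyord n g -> polyord n h -> polyord n (fun s => g s + h s).
Proof. by move=> [l gl] [m hm]; exists (l ++ m) => s; rewrite big_cat gl hm. Qed.

Lemma polyordW m n g : (m <= n)%N -> polyord n g -> polyord m g.
Proof.
move=> mn [l gl]; exists [seq ((n - m + t.1)%N, t.2) | t <- l] => s.
by rewrite gl big_map; apply: eq_bigr => t _; rewrite /= addnA subnKC.
Qed.

Lemma polyordZ m n g : polyord n g -> polyord (m + n) (fun s => s ^+ m *: g s).
Proof.
move=> [l gl]; exists l => s; rewrite gl scaler_sumr.
by apply: eq_bigr => t _; rewrite scalerA -exprD addnA.
Qed.

Lemma polyord_lead n g :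
  polyord n g -> exists c, polyord n.+1 (fun s => g s - s ^+ n *: c).
Proof.
move=> [l]; elim: l g => [|[k x] l IH] g gl.
  exists 0; apply: polyord_ext (polyord0 _) => s.
  by rewrite gl big_nil scaler0 subr0.
have [|c hc] := IH (fun s => \sum_(t <- l) s ^+ (n + t.1) *: t.2); first by [].
case: k gl => [|k] gl.
  exists (x + c); apply: polyord_ext hc => s.
  by rewrite gl big_cons /= addn0 scalerDr opprD addrACA subrr add0r.
have hx : polyord n.+1 (fun s => s ^+ (n.+1 + k) *: x).
  by exists [:: (k, x)] => s; rewrite big_seq1.
exists c; apply: polyord_ext (polyordD hx hc) => s.
by rewrite gl big_cons /= addnS addSn -addrA.
Qed.

End Order.

Lemma polyord_lin (K : fieldType) (X Y : lmodType K) (b : X -> Y) n g :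
  linear b -> polyord n g -> polyord n (fun s => b (g s)).
Proof.
move=> b_lin [l gl]; exists [seq (t.1, b t.2) | t <- l] => s.
rewrite gl linear_sumE // big_map; apply: eq_bigr => t _.
exact: linear_scale.
Qed.

Lemma polyordN (K : fieldType) (X : lmodType K) n (g : K -> X) :
  polyord n g -> polyord n (fun s => - g s).
Proof.
by apply: (@polyord_lin _ _ _ -%R) => k u v; rewrite opprD scalerN.
Qed.

Lemma polyordB (K : fieldType) (X : lmodType K) n (g h : K -> X) :
  polyord n g -> polyord n h -> polyord n (fun s => g s - h s).
Proof. by move=> hg hh; apply: polyordD => //; apply: polyordN. Qed.

Lemma polyord_bilin (K : fieldType) (X Y Z : lmodType K) (b : X -> Y -> Z)
    m n g h :
  (forall y, linear (b^~ y)) -> (forall x, linear (b x)) ->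
  polyord m g -> polyord n h -> polyord (m + n) (fun s => b (g s) (h s)).
Proof.
move=> b_linl b_linr [l gl] hn.
(* Expanding only the first argument avoids a double sum over monomials. *)
apply: (@polyord_ext _ _ _ _
    (fun s => \sum_(t <- l) s ^+ (m + t.1) *: b t.2 (h s))) => [s|].
  rewrite gl (linear_sumE (b_linl _)); apply: eq_bigr => t _.
  exact: (linear_scale (b_linl _)).
elim: l {gl} => [|t l IH].
  by apply: polyord_ext (polyord0 _ _) => s; rewrite big_nil.
apply: (@polyord_ext _ _ _ _
    (fun s => s ^+ (m + t.1) *: b t.2 (h s)
              + \sum_(t <- l) s ^+ (m + t.1) *: b t.2 (h s))) => [s|].
  by rewrite big_cons.
apply: polyordD => //; apply: polyordW (polyordZ _ (polyord_lin _ hn)) => //.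
by rewrite leq_add2r leq_addr.
Qed.

Lemma polyord_poly (K : fieldType) n (g : K -> K^o) :
  polyord n g -> exists p : {poly K}, forall s, g s = s ^+ n * p.[s].
Proof.
move=> [l gl]; exists (\sum_(t <- l) (t.2 : K) *: 'X^(t.1)) => s.
rewrite gl horner_sum mulr_sumr; apply: eq_bigr => t _.
by rewrite hornerZ hornerXn exprD /GRing.scale /= mulrAC mulrA.
Qed.

Section Congruence.
Variables (K : fieldType) (X : lmodType K) (n : nat).
Implicit Types g h k : K -> X.

Lemma polyord_trans g h k :
  polyord n (fun s => g s - h s) -> polyord n (fun s => h s - k s) ->
  polyord n (fun s => g s - k s).
Proof.
move=> gh hk; apply: polyord_ext (polyordD gh hk) => s.
by rewrite addrA subrK.
Qed.

Lemma polyord_shift g h k :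
  polyord n (fun s => g s - h s) ->
  polyord n (fun s => (g s + k s) - (h s + k s)).
Proof. by apply: polyord_ext => s; rewrite opprD addrACA subrr addr0. Qed.

End Congruence.

(** * The rank of a perturbed pencil *)

(** Both determinants are values, at 0 and at x, of one polynomial over R. *)
Lemma det_perturb (R : comNzRingType) n (A B : 'M[R]_n) (x : R) :
  exists c, \det (A + x *: B) = \det A + x * c.
Proof.
pose p := \det (map_mx polyC A + 'X *: map_mx polyC B).
have pE y : p.[y] = \det (A + y *: B).
  rewrite -horner_evalE -det_map_mx; congr (\det _).
  by apply/matrixP => i j; rewrite !mxE /= /horner_eval !hornerE.
have /factor_theorem[q pq] : root (p - p.[0]%:P) 0 by rewrite /root !hornerE subrr.
exists q.[x].
have := congr1 (horner^~ x) pq.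
rewrite !hornerE !pE scale0r addr0 => /eqP.
by rewrite subr_eq subr0 => /eqP->; rewrite addrC mulrC.
Qed.

Section Rank.
Variables (K : fieldType) (A D : vectType K).

Lemma det_coord_rank r (X : r.-tuple D) (a : 'I_r -> A) (g : 'Hom(A, D)) :
  \det (\matrix_(i, j) coord X j (g (a i))) != 0 -> (r <= \dim (limg g))%N.
Proof.
set M := \matrix_(i, j) _ => detM.
pose Y := [tuple g (a i) | i < r].
have YE (i : 'I_r) : Y`_i = g (a i) by rewrite -tnth_nth tnth_mktuple.
have freeY : free Y.
  apply/freeP => k sum0 i.
  pose v := \row_j k j.
  have vM : v *m M = 0.
    apply/rowP => j; rewrite !mxE.
    have := congr1 (coord X j) sum0; rewrite linear_sum linear0 => e.
    rewrite -{}[RHS]e; apply: eq_bigr => l _.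
    by rewrite !mxE linearZ /= YE.
  have : v = 0.
    have uM : M \in unitmx by rewrite unitmxE unitfE.
    by rewrite -[v](mulmxK uM) vM mul0mx.
  by move/rowP/(_ i); rewrite !mxE.
have := freeY; rewrite /free => /eqP; rewrite size_tuple => <-.
apply/dimvS/span_subvP => y /mapP[i _ ->].
exact/memv_img/memvf.
Qed.

Lemma dim_limg_comp_le (A' D' : vectType K) (P : 'Hom(A', A)) (g : 'Hom(A, D))
    (Q : 'Hom(D, D')) :
  (\dim (limg (Q \o g \o P)) <= \dim (limg g))%N.
Proof.
rewrite !limg_comp -(limg_ker_dim Q (limg g)).
apply: leq_trans (leq_addl _ _).
exact/dimvS/limgS/limgS/subvf.
Qed.

End Rank.

(** With r = rank S, choose vectors a_i mapped by S to a basis of its image. The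
    matrix of f + s S on the a_i is then s 1 + M, whose determinant is the
    characteristic polynomial of - M: its coefficient of degree r is 1, and an
    error divisible by s^(r+1) does not affect that coefficient. *)
Lemma rank_perturb (K : closedFieldType) (A D : vectType K) (f S : 'Hom(A, D))
    (G : K -> 'Hom(A, D)) :
  (forall a, polyord (\dim (limg S)).+1
     (fun s => f a + s *: S a - G s a)) ->
  exists s, (\dim (limg S) <= \dim (limg (G s)))%N.
Proof.
set r := \dim _ => hG; pose X := vbasis (limg S).
pose a (i : 'I_r) := (S^-1)%VF X`_i.
have aS i : S (a i) = X`_i.
  rewrite limg_lfunVK //; apply: vbasis_mem.
  by apply/mem_nth; rewrite size_tuple.
have XK i j : coord X j (S (a i)) = (i == j)%:R.
  by rewrite aS coord_free ?(basis_free (vbasisP _)) // eq_sym.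
have /all_sig[E0 hE] : forall ij : 'I_r * 'I_r, {p : {poly K} |
    forall s, coord X ij.2 (f (a ij.1) + s *: S (a ij.1) - G s (a ij.1))
              = s ^+ r.+1 * p.[s]}.
  move=> [i j] /=.
  have /polyord_poly : polyord r.+1 (fun s => coord X j
    (f (a i) + s *: S (a i) - G s (a i)) : K^o).
    by apply: polyord_lin (hG _) => k u v; rewrite linearP.
  by move=> /boolp.cid[p hp]; exists p.
pose M := \matrix_(i, j) coord X j (f (a i)).
pose E := \matrix_(i, j) E0 (i, j).
(* The matrix of the G s on the a i, with entries polynomial in s. *)
pose Y := char_poly_mx (- M) + 'X^(r.+1) *: - E.
have Y_eval s : map_mx (horner_eval s) Y
    = \matrix_(i, j) coord X j (G s (a i)).
  apply/matrixP => i j; rewrite !mxE /= /horner_eval.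
  have := hE (i, j) s; rewrite linearB linearD linearZ /= XK => e.
  rewrite !hornerE hornerMn hornerX mulrN -e opprK mulr_natr.
  by rewrite [s *+ _ + _]addrC opprB addrCA subrr addr0.
have detY : \det Y != 0.
  have [c detE] := det_perturb (char_poly_mx (- M)) (- E) 'X^(r.+1).
  apply/eqP => /(congr1 (fun p : {poly K} => p`_r)).
  rewrite detE coefD coefXnM ltnSn addr0 coef0 => /eqP.
  have /monicP := char_poly_monic (- M).
  by rewrite /lead_coef size_char_poly /= => ->; rewrite oner_eq0.
have /closed_nonrootP[s nz] := detY.
exists s; apply: (@det_coord_rank _ _ _ _ X a).
by rewrite -Y_eval det_map_mx /= /horner_eval.
Qed.

(** * Bimodules as bilinear structures *)

Section Bimodule.
Variables (K : fieldType) (A : fdAlgType K) (V : bimodType A).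
Implicit Types (a b x : A) (u v : V).

Lemma fdmulDl a a' b : (a + a') ** b = a ** b + a' ** b.
Proof. exact: (linear_add (fdmul_linearl b)). Qed.
Lemma fdmulDr a b b' : a ** (b + b') = a ** b + a ** b'.
Proof. exact: (linear_add (fdmul_linearr a)). Qed.
Lemma fdmulNr a b : a ** (- b) = - (a ** b).
Proof. exact: (linear_opp (fdmul_linearr a)). Qed.
Lemma fdmulZl k a b : (k *: a) ** b = k *: (a ** b).
Proof. exact: (linear_scale (fdmul_linearl b)). Qed.
Lemma fdmulZr k a b : a ** (k *: b) = k *: (a ** b).
Proof. exact: (linear_scale (fdmul_linearr a)). Qed.
Lemma fdmul0l b : 0 ** b = 0 :> A.
Proof. exact: (linear_zero (fdmul_linearl b)). Qed.
Lemma fdmul0r a : a ** 0 = 0 :> A.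
Proof. exact: (linear_zero (fdmul_linearr a)). Qed.

Lemma lactDl a a' v : lact (a + a') v = lact a v + lact a' v.
Proof. exact: (linear_add (lact_linearl v)). Qed.
Lemma lactDr a u v : lact a (u + v) = lact a u + lact a v.
Proof. exact: (linear_add (lact_linearr a)). Qed.
Lemma lactNr a v : lact a (- v) = - lact a v.
Proof. exact: (linear_opp (lact_linearr a)). Qed.
Lemma lact0l v : lact 0 v = 0.
Proof. exact: (linear_zero (lact_linearl v)). Qed.

Lemma ractDl u v a : ract (u + v) a = ract u a + ract v a.
Proof. exact: (linear_add (ract_linearl a)). Qed.
Lemma ractDr v a a' : ract v (a + a') = ract v a + ract v a'.
Proof. exact: (linear_add (ract_linearr v)). Qed.
Lemma ractNl v a : ract (- v) a = - ract v a.
Proof. exact: (linear_opp (ract_linearl a)). Qed.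
Lemma ractNr v a : ract v (- a) = - ract v a.
Proof. exact: (linear_opp (ract_linearr v)). Qed.
Lemma ract0l a : ract 0 a = 0 :> V.
Proof. exact: (linear_zero (ract_linearl a)). Qed.
Lemma ract0r v : ract v 0 = 0.
Proof. exact: (linear_zero (ract_linearr v)). Qed.

Lemma polyord_fdmul m n (g h : K -> A) :
  polyord m g -> polyord n h -> polyord (m + n) (fun s => g s ** h s).
Proof. exact: (polyord_bilin (@fdmul_linearl _ _) (@fdmul_linearr _ _)). Qed.
Lemma polyord_lact m n (g : K -> A) (h : K -> V) :
  polyord m g -> polyord n h -> polyord (m + n) (fun s => lact (g s) (h s)).
Proof. exact: (polyord_bilin (@lact_linearl _ _ _) (@lact_linearr _ _ _)). Qed.
Lemma polyord_ract m n (g : K -> V) (h : K -> A) :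
  polyord m g -> polyord n h -> polyord (m + n) (fun s => ract (g s) (h s)).
Proof. exact: (polyord_bilin (@ract_linearl _ _ _) (@ract_linearr _ _ _)). Qed.

End Bimodule.

(** * Peirce decomposition of a bimodule *)

Section Peirce.
Variables (K : fieldType) (A : fdAlgType K) (W : bimodType A).
Variables (eI eJ : A) (hI : eI ** eI = eI) (hJ : eJ ** eJ = eJ).
Variables (hIJ : eI ** eJ = 0) (hJI : eJ ** eI = 0) (h1 : fdone = eI + eJ).

Definition diagonal (d : W) : Prop :=
  dcut eI eJ d = 0 /\ dcut eJ eI d = 0.

Lemma dcut_comp a b e e' (v : W) :
  dcut a b (dcut e e' v) = ract (lact (a ** e) v) (e' ** b).
Proof. by rewrite /dcut -lactA -lactM -ractM. Qed.

Lemma peirce_split (v : W) :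
  v = dcut eI eI v + dcut eJ eJ v + (dcut eI eJ v + dcut eJ eI v).
Proof.
rewrite -{1}[v]lact1 -{1}[lact _ _]ract1 h1 lactDl !ractDr !ractDl /dcut.
by rewrite [_ + ract (lact eJ v) eJ]addrC addrACA [ract (lact eJ v) eI + _]addrC.
Qed.

Lemma dmix_cut (v : W) :
  v \in dmix W eI eJ -> dcut eI eI v = 0 /\ dcut eJ eJ v = 0.
Proof.
case/memv_addP=> _ /dpeirceP[x ->] [_ /dpeirceP[y ->] ->].
split; rewrite linearD /= -!/(dcut _ _ _) !dcut_comp;
  by rewrite ?hIJ ?hJI !(ract0r, lact0l, ract0l) addr0.
Qed.

Lemma dcut_mem e e' (v : W) : dcut e e' v \in dpeirce W e e'.
Proof. by apply/dpeirceP; exists v. Qed.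

Lemma diag_cut (v : W) :
  v \in (dpeirce W eI eI + dpeirce W eJ eJ)%VS -> diagonal v.
Proof.
case/memv_addP=> _ /dpeirceP[x ->] [_ /dpeirceP[y ->] ->].
split; rewrite linearD /= -!/(dcut _ _ _) !dcut_comp;
  by rewrite ?hIJ ?hJI !(ract0r, lact0l, ract0l) addr0.
Qed.

(** The three summands are independent: the four Peirce components of a vector
    in a pairwise intersection vanish. *)
Lemma dim_peirce :
  (\dim (dpeirce W eI eI) + \dim (dpeirce W eJ eJ) + \dim (dmix W eI eJ)
   <= \dim {:W})%N.
Proof.
rewrite -!dimv_disjoint_sum ?dimvS ?subvf //.
  apply/eqP; rewrite -subv0; apply/subvP => v; rewrite memv_cap memv0.
  case/andP=> /diag_cut[vIJ vJI] /dmix_cut[vII vJJ].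
  by rewrite (peirce_split v) vIJ vJI vII vJJ !addr0.
apply/eqP; rewrite -subv0; apply/subvP => v; rewrite memv_cap memv0.
case/andP=> /(dpeirce_id hI)[<- _] /(dpeirce_id hJ)[<- _].
by rewrite -lactM hJI lact0l.
Qed.

End Peirce.

(** * Gauge transformations *)

Section Gauge.
Variables (K : fieldType) (A : fdAlgType K) (V : bimodType A).
Variables (f : 'Hom(A, V)) (f_der : derivation f).

(** lam' = (f(w) + w lam) w^-1 for a curve w of units that is polynomial in s
    together with its inverse. *)
Definition gauge (lam lam' : K -> V) : Prop :=
  exists w w' : K -> A,
    [/\ polyord 0 w /\ polyord 0 w',
        forall s, w s ** w' s = fdone,
        forall s, w' s ** w s = fdone
      & forall s, f (w s) + lact (w s) (lam s) = ract (lam' s) (w s)].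

Lemma derivation1 : f fdone = 0.
Proof.
have := f_der fdone fdone; rewrite fdmul1a lact1 ract1 => /eqP.
by rewrite addrC -subr_eq subrr => /eqP.
Qed.

Lemma gauge_refl lam : gauge lam lam.
Proof.
exists (fun=> fdone), (fun=> fdone); split.
- by split; apply: polyord_const.
- by move=> s; rewrite fdmul1a.
- by move=> s; rewrite fdmul1a.
- by move=> s; rewrite derivation1 lact1 ract1 add0r.
Qed.

Lemma gauge_trans lam1 lam2 lam3 :
  gauge lam1 lam2 -> gauge lam2 lam3 -> gauge lam1 lam3.
Proof.
move=> [w [w' [[pw pw'] ww' w'w hw]]] [v [v' [[pv pv'] vv' v'v hv]]].
exists (fun s => v s ** w s), (fun s => w' s ** v' s); split.
- by split; apply: (@polyord_fdmul _ _ 0 0).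
- by move=> s; rewrite fdmulA -(fdmulA (v s)) ww' fdmula1 vv'.
- by move=> s; rewrite fdmulA -(fdmulA (w' s)) v'v fdmula1 w'w.
- move=> s; rewrite f_der lactM addrAC -lactDr hw.
  by rewrite -lactA -ractDl [lact _ _ + _]addrC hv ractM.
Qed.

(** The gauge transformation by 1 + s^n x, which is polynomially invertible
    because x has square zero. As lam vanishes at s = 0 and n > 0, the terms in
    x lam, lam x and f(x) x contribute only from order n + 1 on, which leaves
    s^n f(x). *)
Lemma gauge_step n lam x :
  (0 < n)%N -> polyord 1 lam -> x ** x = 0 ->
  exists lam', gauge lam lam' /\
    polyord n.+1 (fun s => lam' s - (lam s + s ^+ n *: f x)).
Proof.
move=> n_gt0 plam xx0.
pose y s := s ^+ n *: x.
have py : polyord n y.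
  by have := polyordZ n (polyord_const x); rewrite addn0.
have yy s : y s ** y s = 0 by rewrite fdmulZl fdmulZr xx0 !scaler0.
have pz : polyord n (fun s => f (y s)).
  by apply: (@polyord_lin _ _ _ f) => // k a b; rewrite linearP.
have py1 := polyord_const (fdone : A).
exists (fun s => ract (f (y s) + (lam s + lact (y s) (lam s))) (fdone - y s)).
split.
  exists (fun s => fdone + y s), (fun s => fdone - y s).
  have inv1 s : (fdone + y s) ** (fdone - y s) = fdone.
    rewrite fdmulDl !fdmulDr !fdmulNr yy fdmul1a !fdmula1 fdmul1a oppr0 addr0.
    by rewrite subrK.
  have inv2 s : (fdone - y s) ** (fdone + y s) = fdone.
    rewrite fdmulDr !fdmulDl fdmula1 !fdmul1a fdmula1.
    rewrite -[- y s]scaleN1r fdmulZl yy scaler0 addr0 scaleN1r.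
    by rewrite subrK.
  split => // [|s].
    by split; [apply: polyordD|apply: polyordB] => //; apply: polyordW py.
  rewrite -ractM inv2 ract1 linearD /= derivation1 add0r.
  by rewrite lactDl lact1.
pose t s := f (y s) + (lam s + lact (y s) (lam s)).
have pt : polyord 1 t.
  apply: polyordD; first exact: polyordW pz.
  apply: polyordD => //; apply: polyordW (polyord_lact py plam).
  by rewrite addn1.
apply: (@polyord_ext _ _ _ _
    (fun s => lact (y s) (lam s) - ract (t s) (y s))); last first.
  apply: polyordB; last by rewrite -add1n; apply: polyord_ract.
  by rewrite -addn1; apply: polyord_lact.
move=> s; rewrite -/(t s) ractDr ract1 ractNr addrAC; congr (_ - _).
by rewrite /t linearZ /= addrA [_ + lam s]addrC addrC addKr.
Qed.

(** Substituting a = v^-1 b w and expanding f(v^-1 b w) by the Leibniz rule, the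
    terms f(v^-1) and f(w) are absorbed into mu and lam. *)
Lemma gauge_pencil lam lam' mu mu' :
  gauge lam lam' -> gauge mu mu' ->
  exists v v' w w' : K -> A,
    [/\ polyord 0 v /\ polyord 0 v', polyord 0 w /\ polyord 0 w'
      & forall s a, let b := v s ** a ** w' s in
          f a + (lact a (lam s) - ract (mu s) a) =
          ract (lact (v' s) (f b + (lact b (lam' s) - ract (mu' s) b))) (w s)].
Proof.
move=> [w [w' [pw ww' w'w hw]]] [v [v' [pv vv' v'v hv]]].
exists v, v', w, w'; split => // s a b.
have aE : a = v' s ** b ** w s.
  by rewrite /b !fdmulA v'v fdmul1a -fdmulA w'w fdmula1.
have fw : f (w s) = ract (lam' s) (w s) - lact (w s) (lam s).
  by rewrite -hw addrK.
have fv' : f (v' s) = ract (mu s) (v' s) - lact (v' s) (mu' s).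
  have := f_der (v' s) (v s); rewrite v'v derivation1.
  have -> : f (v s) = ract (mu' s) (v s) - lact (v s) (mu s).
    by rewrite -hv addrK.
  move=> /esym/eqP; rewrite addrC addr_eq0 => /eqP /(congr1 (ract^~ (v' s))).
  rewrite -ractM vv' ract1 => ->.
  rewrite lactDr lactNr -lactM v'v lact1 opprD opprK ractDl.
  by rewrite ractNl -lactA -ractM vv' ract1 addrC.
clearbody b; rewrite {1 2 3}aE !f_der fw fv'.
rewrite !(lactDr, lactNr, ractDl, ractNl, ractM, lactM, lactA).
by rewrite addrAC [_ - _ + (_ - _)]addrA subrK addrCA [_ - _ + (_ - _)]addrA subrK.
Qed.

(** * Diagonalization to arbitrary order *)

Section Diagonal.
Variables (eI eJ : A) (hI : eI ** eI = eI) (hJ : eJ ** eJ = eJ).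
Variables (hIJ : eI ** eJ = 0) (hJI : eJ ** eI = 0) (h1 : fdone = eI + eJ).
Hypothesis f_bilin : bilinear_over (adiag eI eJ) f.
Hypothesis f_mix : limg f = dmix V eI eJ.

Lemma bilinear_cut e e' a :
  e \in adiag eI eJ -> e' \in adiag eI eJ -> f (acut e e' a) = dcut e e' (f a).
Proof.
by move=> ed e'd; rewrite (f_bilin _ e'd).2 (f_bilin _ ed).1.
Qed.

Lemma eI_diag : eI \in adiag eI eJ.
Proof.
by apply: (subvP (addvSl _ _)); apply/apeirceP; exists eI; rewrite !hI.
Qed.

Lemma eJ_diag : eJ \in adiag eI eJ.
Proof.
by apply: (subvP (addvSr _ _)); apply/apeirceP; exists eJ; rewrite !hJ.
Qed.

(** Peirce components of a preimage are again preimages because f commutes with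
    the idempotents, and an off-diagonal element e a e' has square zero. *)
Lemma offdiagonal_preimage e e' (c : V) :
  e \in adiag eI eJ -> e' \in adiag eI eJ -> e ** e = e -> e' ** e' = e' ->
  e' ** e = 0 -> dcut e e' c \in limg f ->
  exists x, x ** x = 0 /\ f x = - dcut e e' c.
Proof.
move=> ed e'd ee e'e' e'e; rewrite -memvN => /memv_imgP[a _ aE].
exists (acut e e' a); split.
  by rewrite /acut !fdmulA -(fdmulA (e ** a)) e'e fdmul0r !fdmul0l.
by rewrite bilinear_cut // -aE linearN /= /dcut -lactA -lactM ee -ractM e'e'.
Qed.

(** Induction on n: if c is the coefficient of s^(n+1) in the error lam' - d, the
    steps along x and y with f(x) = - c_IJ and f(y) = - c_JI cancel its
    off-diagonal part, and its diagonal part is added to d. *)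
Lemma gauge_diagonal n lam :
  polyord 1 lam ->
  exists lam' d, [/\ gauge lam lam', polyord 1 d, forall s, diagonal eI eJ (d s)
    & polyord n.+1 (fun s => lam' s - d s)].
Proof.
move=> plam; elim: n => [|n [lam0 [d [g0 pd diag_d /polyord_lead[c]]]]].
  exists lam, (fun=> 0); split; [exact: gauge_refl|exact: polyord0| |].
    by move=> _; split; exact: linear0.
  by apply: polyord_ext plam => s; rewrite subr0.
move=> pc.
have [x [xx fx]] : exists x, x ** x = 0 /\ f x = - dcut eI eJ c.
  apply: offdiagonal_preimage eI_diag eJ_diag hI hJ hJI _.
  by rewrite f_mix; apply: (subvP (addvSl _ _)); apply/dpeirceP; exists c.
have [y [yy fy]] : exists y, y ** y = 0 /\ f y = - dcut eJ eI c.
  apply: offdiagonal_preimage eJ_diag eI_diag hJ hI hIJ _.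
  by rewrite f_mix; apply: (subvP (addvSr _ _)); apply/dpeirceP; exists c.
have pmon z : polyord n.+1 (fun s => s ^+ n.+1 *: z : V).
  by have := polyordZ n.+1 (polyord_const z); rewrite addn0.
have plam0 : polyord 1 lam0.
  have pdc := polyordD pd (polyordW (isT : (1 <= n.+1)%N) (pmon c)).
  apply: polyord_ext (polyordD pdc (polyordW (isT : (1 <= n.+2)%N) pc)) => s.
  by rewrite -(addrA (lam0 s)) -opprD [RHS]addrC subrK.
have [lam1 [g1 h1']] := gauge_step (ltn0Sn n) plam0 xx.
have plam1 : polyord 1 lam1.
  have pdc := polyordD plam0 (polyordW (isT : (1 <= n.+1)%N) (pmon (f x))).
  apply: polyord_ext (polyordD pdc (polyordW (isT : (1 <= n.+2)%N) h1')) => s.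
  by rewrite [RHS]addrC subrK.
have [lam2 [g2 h2]] := gauge_step (ltn0Sn n) plam1 yy.
pose c' := dcut eI eI c + dcut eJ eJ c.
have cE : c + f x + f y = c'.
  by rewrite {1}(peirce_split h1 c) fx fy -(addrA _ (- _)) -opprD addrK.
exists lam2, (fun s => d s + s ^+ n.+1 *: c'); split.
- exact: gauge_trans g0 (gauge_trans g1 g2).
- by apply: polyordD => //; apply: polyordW (pmon _).
- move=> s; have [dIJ dJI] := diag_d s.
  split; rewrite linearD linearZ /= (dIJ, dJI) add0r /c' linearD /= !dcut_comp.
    by rewrite hIJ ract0r lact0l ract0l addr0 scaler0.
  by rewrite hJI ract0r lact0l ract0l addr0 scaler0.
apply: polyord_trans h2 _.
apply: polyord_trans (polyord_shift (fun s => s ^+ n.+1 *: f y) h1') _.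
apply: polyord_ext pc => s.
rewrite -cE !scalerDr [d s + _]addrA [d s + (_ + _)]addrA.
rewrite opprD [LHS]addrACA subrr addr0 opprD [LHS]addrACA subrr addr0.
by rewrite opprD addrA.
Qed.
End Diagonal.
End Gauge.

(** * A diagonal pencil of large rank *)

(** Undoing the gauge transformations around f + S_(d,d') gives a family that
    agrees with f + s S_(lam,mu) to high order in s, so [rank_perturb] applies;
    composing with multiplications cannot increase the rank. *)
Lemma diagonal_pencil_rank (K : closedFieldType) (A : fdAlgType K) (V : bimodType A)
    (f : 'Hom(A, V)) (lam mu : V) (lam' mu' d d' : K -> V) :
  derivation f ->
  gauge f (fun s => s *: lam) lam' -> gauge f (fun s => s *: mu) mu' ->
  polyord (\dim (limg (smap lam mu))).+1 (fun s => lam' s - d s) ->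
  polyord (\dim (limg (smap lam mu))).+1 (fun s => mu' s - d' s) ->
  exists s, (\dim (limg (smap lam mu))
             <= \dim (limg (f + smap (d s) (d' s))%R))%N.
Proof.
move=> f_der glam gmu; set r := \dim _ => pd pd'.
have [v [v' [w [w' [[pv pv'] [pw pw'] fE]]]]] := gauge_pencil f_der glam gmu.
pose T s := f + smap (d s) (d' s).
pose G s := (linfun (dcut (D := V) (v' s) (w s)) \o T s
              \o linfun (acut (v s) (w' s)))%VF.
have [a|s rG] := @rank_perturb K A V f (smap lam mu) G; last first.
  by exists s; apply: leq_trans rG (dim_limg_comp_le _ _ _).
pose b s := v s ** a ** w' s.
have pb : polyord 0 b.
  have pa := polyord_const a.
  exact: (polyord_fdmul (polyord_fdmul pv pa) pw').
have pE : polyord r.+1 (fun s => dcut (v' s) (w s)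
    (lact (b s) (lam' s - d s) - ract (mu' s - d' s) (b s))).
  rewrite -[r.+1]addn0; apply: polyord_ract pw.
  rewrite -[r.+1]add0n; apply: polyord_lact pv' _.
  apply: polyordB; first by rewrite -[r.+1]add0n; apply: polyord_lact.
  by rewrite -[r.+1]addn0; apply: polyord_ract.
apply: polyord_ext pE => s.
have -> : f a + s *: smap lam mu a
    = dcut (v' s) (w s)
        (f (b s) + (lact (b s) (lam' s) - ract (mu' s) (b s))).
  rewrite -[RHS]/(ract (lact _ _) _) -fE smapE scalerBr.
  by rewrite (linear_scale (lact_linearr _)) (linear_scale (ract_linearl _)).
rewrite !comp_lfunE !lfunE /= smapE -/(b s) -linearB; congr (dcut _ _ _).
rewrite opprD addrACA subrr add0r lactDr lactNr ractDl ractNl.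
by rewrite !opprD !opprK addrACA.
Qed.

(** * Comparison with the corners *)

Lemma corank_arith dI dJ m dD rI rJ rS q p c :
  (rI <= dI -> rJ <= dJ -> dI + dJ + m <= dD -> rS <= c + q -> q <= p ->
   p + c <= rI + rJ + m -> (dI - rI) + (dJ - rJ) <= dD - rS)%N.
Proof. lia. Qed.

Section CornerRank.
Variables (K : fieldType) (A : fdAlgType K) (D : bimodType A).
Variables (F : {vspace D}) (hF : subbimodule F).
Local Notation V := (bquot hF).

Definition quot_map : 'Hom(D, V) := linfun (vpi F : D -> V).

Lemma quot_mapE d : quot_map d = vpi F d.
Proof. by rewrite lfunE. Qed.

Lemma quot_map_lact a d : quot_map (lact a d) = lact a (quot_map d).
Proof. by rewrite !quot_mapE -(bquot_lact_pi hF). Qed.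

Lemma quot_map_ract d a : quot_map (ract d a) = ract (quot_map d) a.
Proof. by rewrite !quot_mapE -(bquot_ract_pi hF). Qed.

Lemma quot_map_cut e e' d : quot_map (dcut e e' d) = dcut e e' (quot_map d).
Proof. by rewrite /dcut quot_map_ract quot_map_lact. Qed.

Lemma lker_quot_map : lker quot_map = F.
Proof.
apply/vspaceP => v; rewrite memv_ker quot_mapE -(raddf0 (vpi F)).
by rewrite [LHS]vpi_eq subr0.
Qed.

Lemma quot_map_repr (v : V) : quot_map (vrepr v) = v.
Proof. by rewrite quot_mapE [LHS]vreprK. Qed.

(** The corner e D e itself is needed here, not that of D/F, so the e-e component
    is lifted through a representative. *)
Definition corner_part e (he : e ** e = e) (d : V) : bcorner D he :=
  Subvs (dcut_mem e e (vrepr d : D)).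

(** If d and d' respect the decomposition at e, the e-e component of
    a d - d' a only involves the e-e components of a, d and d'. *)
Lemma smap_corner e (he : e ** e = e) (d d' : V) a :
  lact e (ract d e) = ract d e -> ract (lact e d') e = lact e d' ->
  dcut e e (smap d d' a) \in
   (quot_map @: (linfun (vsval : bcorner D he -> D) @:
      limg (smap (corner_part he d) (corner_part he d'))))%VS.
Proof.
move=> de ed'.
have ea : acut e e a \in apeirce e e by apply/apeirceP; exists a.
pose x : corner he := Subvs ea.
have -> : dcut e e (smap d d' a) = quot_map (linfun (vsval : bcorner D he -> D)
    (smap (corner_part he d) (corner_part he d') x)).
  rewrite [linfun _ _]lfunE /= [smap _ _ x]smapE /= linearB /=.
  rewrite quot_map_lact (quot_map_ract (dcut _ _ _)) !quot_map_cut !quot_map_repr.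
  have -> : dcut e e d = ract d e by rewrite /dcut lactA de.
  rewrite {2}/dcut ed' smapE linearB /=.
  by rewrite /acut !lactM de !ractM ed' /dcut !lactA.
exact/memv_img/memv_img/memv_img/memvf.
Qed.

Lemma quot_map_mem_dpeirce e e' (v : V) :
  dcut e e' v \in (quot_map @: dpeirce D e e')%VS.
Proof. by rewrite -(quot_map_repr v) -quot_map_cut memv_img ?dcut_mem. Qed.

Lemma dim_img_le (U W : vectType K) (g : 'Hom(U, W)) (X : {vspace U}) :
  (\dim (g @: X) <= \dim X)%N.
Proof. by rewrite -(limg_ker_dim g X) leq_addl. Qed.

Lemma dim_quot_map_img (X : {vspace D}) :
  (\dim X <= \dim F + \dim (quot_map @: X))%N.
Proof.
rewrite -(limg_ker_dim quot_map X) leq_add2r lker_quot_map.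
exact/dimvS/capvSr.
Qed.

Variables (eI eJ : A) (hI : eI ** eI = eI) (hJ : eJ ** eJ = eJ).
Variables (hIJ : eI ** eJ = 0) (hJI : eJ ** eI = 0) (h1 : fdone = eI + eJ).
Hypothesis Fmix : (F <= dmix D eI eJ)%VS.

(** Each Peirce component of the image is bounded separately: f contributes
    nothing to the two diagonal ones, and the off-diagonal one lies in
    D_mix / F. *)
Lemma limg_diagonal_pencil (f : 'Hom(A, V)) (d d' : V) :
  limg f = dmix V eI eJ -> diagonal eI eJ d -> diagonal eI eJ d' ->
  (\dim (limg (f + smap d d')%R) + \dim F <=
   \dim (limg (smap (corner_part hI d) (corner_part hI d'))) +
   \dim (limg (smap (corner_part hJ d) (corner_part hJ d'))) +
   \dim (dmix D eI eJ))%N.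
Proof.
move=> f_mix [dIJ dJI] [d'IJ d'JI].
set SI := limg (smap (corner_part hI d) _).
set SJ := limg (smap (corner_part hJ d) _).
pose VI := (quot_map @: (linfun (vsval : bcorner D hI -> D) @: SI))%VS.
pose VJ := (quot_map @: (linfun (vsval : bcorner D hJ -> D) @: SJ))%VS.
pose VM := (quot_map @: dmix D eI eJ)%VS.
have sub : (limg (f + smap d d')%R <= VI + VJ + VM)%VS.
  apply/subvP => _ /memv_imgP[a _ ->].
  rewrite add_lfunE [_ + _](peirce_split h1).
  have [fII fJJ] : dcut eI eI (f a) = 0 /\ dcut eJ eJ (f a) = 0.
    by apply: dmix_cut => //; rewrite -f_mix memv_img ?memvf.
  rewrite !(linearD (dcut eI eI)) !(linearD (dcut eJ eJ)) /= fII fJJ !add0r.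
  apply: memv_add; last first.
    rewrite /VM /dmix limgD; apply: memv_add; exact: quot_map_mem_dpeirce.
  apply: memv_add.
    apply: smap_corner.
      rewrite -[in RHS](lact1 (ract d eI)) h1 lactDl -[lact eJ _]lactA.
      by rewrite -/(dcut eJ eI d) dJI addr0.
    rewrite -[in RHS](ract1 (lact eI d')) h1 ractDr.
    by rewrite -/(dcut eI eJ d') d'IJ addr0.
  apply: smap_corner.
    rewrite -[in RHS](lact1 (ract d eJ)) h1 lactDl -[lact eI _]lactA.
    by rewrite -/(dcut eI eJ d) dIJ add0r.
  rewrite -[in RHS](ract1 (lact eJ d')) h1 ractDr.
  by rewrite -/(dcut eJ eI d') d'JI add0r.
have dVI : (\dim VI <= \dim SI)%N by exact: leq_trans (dim_img_le _ _) (dim_img_le _ _).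
have dVJ : (\dim VJ <= \dim SJ)%N by exact: leq_trans (dim_img_le _ _) (dim_img_le _ _).
have dVM : (\dim VM + \dim F = \dim (dmix D eI eJ))%N.
  rewrite -(limg_ker_dim quot_map (dmix D eI eJ)) lker_quot_map addnC.
  by rewrite (capv_idPr Fmix).
rewrite -dVM addnA leq_add2r; apply: leq_trans (dimvS sub) _.
apply: leq_trans (dimv_add_leqif _ _) _; rewrite leq_add2r.
apply: leq_trans (dimv_add_leqif _ _) _; exact: leq_add.
Qed.

Lemma corank_corner_le (f : 'Hom(A, V)) (lam mu : D) (d d' : V) :
  limg f = dmix V eI eJ -> diagonal eI eJ d -> diagonal eI eJ d' ->
  (\dim (limg (smap (quot_map lam) (quot_map mu)))
     <= \dim (limg (f + smap d d')%R))%N ->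
  (corank (smap (corner_part hI d) (corner_part hI d')) +
   corank (smap (corner_part hJ d) (corner_part hJ d'))
   <= corank (smap lam mu))%N.
Proof.
move=> f_mix dd dd' rS; rewrite !corankE.
have rD := dim_quot_map_img (limg (smap lam mu)).
rewrite -limg_comp in rD.
have compE : (quot_map \o smap lam mu)%VF = smap (quot_map lam) (quot_map mu).
  apply/lfunP => a.
  by rewrite comp_lfunE !smapE linearB /= quot_map_lact quot_map_ract.
rewrite compE in rD.
have dimI : \dim {: bcorner D hI} = \dim (dpeirce D eI eI) by rewrite dimvf.
have dimJ : \dim {: bcorner D hJ} = \dim (dpeirce D eJ eJ) by rewrite dimvf.
have rI := dimvS (subvf (limg (smap (corner_part hI d) (corner_part hI d')))).
have rJ := dimvS (subvf (limg (smap (corner_part hJ d) (corner_part hJ d')))).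
have dimD := dim_peirce D hI hJ hIJ hJI h1.
rewrite -dimI -dimJ in dimD.
exact: corank_arith rI rJ dimD rD rS (limg_diagonal_pencil f_mix dd dd').
Qed.
End CornerRank.

(** * The inequality *)

Theorem proposition2p3 (K : closedFieldType) (A : fdAlgType K) (D : bimodType A)
    (eI eJ : A) (hI : eI ** eI = eI) (hJ : eJ ** eJ = eJ)
    (hIJ : eI ** eJ = 0) (hJI : eJ ** eI = 0) (h1 : fdone = eI + eJ)
    (F : {vspace D}) (hF : subbimodule F) (hFmix : (F <= dmix D eI eJ)%VS)
    (hf : exists f : 'Hom(A, bquot hF),
        [/\ derivation f, bilinear_over (adiag eI eJ) f
          & limg f = dmix (bquot hF) eI eJ]) :
  [/\ (dsharp (bcorner D hI) + dsharp (bcorner D hJ) <= dsharp D)%N,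
      (dflat (bcorner D hI) + dflat (bcorner D hJ) <= dflat D)%N,
      (prehomogeneous D ->
         prehomogeneous (bcorner D hI) /\ prehomogeneous (bcorner D hJ))
    & (pseudoprehomogeneous D ->
         pseudoprehomogeneous (bcorner D hI) /\
         pseudoprehomogeneous (bcorner D hJ))].
Proof.
have [f [f_der f_bilin f_mix]] := hf.
have pencil n (x : D) : exists lam' d : K -> bquot hF,
    [/\ gauge f (fun s => s *: quot_map hF x) lam',
        forall s, diagonal eI eJ (d s)
      & polyord n.+1 (fun s => lam' s - d s)].
  have plin : polyord 1 (fun s => s *: quot_map hF x).
    by apply: polyord_ext (polyordZ 1 (polyord_const (quot_map hF x))).
  have [lam' [d [g _ dd pd]]] := gauge_diagonal f_der hI hJ hIJ hJI h1
    f_bilin f_mix n plin.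
  by exists lam', d.
have sharp : (dsharp (bcorner D hI) + dsharp (bcorner D hJ) <= dsharp D)%N.
  have [lam <-] : exists lam : D, corank (smap lam lam) = dsharp D.
    exact: minval_attained.
  have [lam' [d [g dd pd]]] :=
    pencil (\dim (limg (smap (quot_map hF lam) (quot_map hF lam)))) lam.
  have [s rs] := diagonal_pencil_rank f_der g g pd pd.
  have := corank_corner_le hI hJ hIJ hJI h1 hFmix f_mix (dd s) (dd s) rs.
  apply: leq_trans; apply: leq_add.
    exact: (minval_le 0 (fun l => corank (smap l l)) (corner_part hI (d s))).
  exact: (minval_le 0 (fun l => corank (smap l l)) (corner_part hJ (d s))).
have flat : (dflat (bcorner D hI) + dflat (bcorner D hJ) <= dflat D)%N.
  have [[lam mu] /= <-] :
      exists p : D * D, corank (smap p.1 p.2) = dflat D.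
    exact: minval_attained.
  have [lam' [d [g dd pd]]] :=
    pencil (\dim (limg (smap (quot_map hF lam) (quot_map hF mu)))) lam.
  have [mu' [d' [g' dd' pd']]] :=
    pencil (\dim (limg (smap (quot_map hF lam) (quot_map hF mu)))) mu.
  have [s rs] := diagonal_pencil_rank f_der g g' pd pd'.
  have := corank_corner_le hI hJ hIJ hJI h1 hFmix f_mix (dd s) (dd' s) rs.
  apply: leq_trans; apply: leq_add.
    exact: (minval_le (0, 0) (fun p => corank (smap p.1 p.2))
      (corner_part hI (d s), corner_part hI (d' s))).
  exact: (minval_le (0, 0) (fun p => corank (smap p.1 p.2))
      (corner_part hJ (d s), corner_part hJ (d' s))).
split=> //.
- move=> D0; move: sharp; rewrite D0 leqn0 addn_eq0 => /andP[/eqP ? /eqP ?].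
  by split.
- move=> D0; move: flat; rewrite D0 leqn0 addn_eq0 => /andP[/eqP ? /eqP ?].
  by split.
Qed.
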